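(* Let $a\in\mathbb{I}_1\setminus K$. Then (1) $\mathrm{Cen}_{\mathbb{I}_1}(a)$ is a finitely generated algebra iff $a\notin(K[H]+F)\setminus(K+F)$. (2) $\mathrm{Cen}_{\mathbb{I}_1}(a)$ is a finitely generated and not Noetherian (equivalently: finitely generated and not left Noetherian; equivalently: finitely generated and not right Noetherian) algebra iff $a\in(K+F)\setminus K$. (3) $\mathrm{Cen}_{\mathbb{I}_1}(a)$ is a not finitely generated and not Noetherian (equivalently: not finitely generated and not left Noetherian; equivalently: not finitely generated and not right Noetherian) algebra iff $a\in(K[H]+F)\setminus(K+F)$.
   Context: $K$ is a field of characteristic zero. $\mathbb{I}_1$ is the subalgebra of $\mathrm{End}_K(K[x])$ generated by (multiplication by) $x$, $\partial=\frac{d}{dx}$ and $\int: x^n\mapsto \frac{x^{n+1}}{n+1}$. Put $H:=\partial x$, $e_{ij}:=\int^i\partial^j-\int^{i+1}\partial^{j+1}$ ($i,j\ge0$) and $F:=\bigoplus_{i,j\ge0}Ke_{ij}$, an ideal of $\mathbb{I}_1$. $\mathrm{Cen}_{\mathbb{I}_1}(a)$ is the centralizer of $a$ in $\mathbb{I}_1$. Noetherian means left and right Noetherian. *)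

(* Defs.v *)
From HB Require Import structures.
From mathcomp Require Import all_boot all_order all_algebra.
From mathcomp Require Import boolp classical_sets.
Set Implicit Arguments.
Unset Strict Implicit.
Unset Printing Implicit Defensive.
Import GRing.Theory.
Local Open Scope classical_set_scope.
Local Open Scope ring_scope.

(* The K-algebra End_K(K[x]); its product is composition of maps. *)
Definition polyEnd (K : fieldType) := {linear {poly K} -> {poly K}}.

Section PolyEndAlgebra.
Variable K : fieldType.
Implicit Types f g h : polyEnd K.

HB.instance Definition _ := gen_eqMixin (polyEnd K).
HB.instance Definition _ := gen_choiceMixin (polyEnd K).

Lemma polyEndP f g : (forall p, f p = g p) -> f = g.
Proof.
case: f g => [f [[fD] [fZ]]] [g [[gD] [gZ]]] /= /funext fg; subst g.
by rewrite (Prop_irrelevance fD gD) (Prop_irrelevance fZ gZ).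
Qed.

Definition polyEnd_zero : polyEnd K := \0 : {linear {poly K} -> {poly K}}.
Definition polyEnd_opp f : polyEnd K := \- f : {linear {poly K} -> {poly K}}.
Definition polyEnd_add f g : polyEnd K :=
  f \+ g : {linear {poly K} -> {poly K}}.
Definition polyEnd_one : polyEnd K := idfun : {linear {poly K} -> {poly K}}.
Definition polyEnd_mul f g : polyEnd K :=
  f \o g : {linear {poly K} -> {poly K}}.
Definition polyEnd_scale (c : K) f : polyEnd K :=
  c \*: f : {linear {poly K} -> {poly K}}.

Fact polyEnd_addA : associative polyEnd_add.
Proof. by move=> f g h; apply: polyEndP => p /=; rewrite addrA. Qed.
Fact polyEnd_addC : commutative polyEnd_add.
Proof. by move=> f g; apply: polyEndP => p /=; rewrite addrC. Qed.
Fact polyEnd_add0 : left_id polyEnd_zero polyEnd_add.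
Proof. by move=> f; apply: polyEndP => p /=; rewrite add0r. Qed.
Fact polyEnd_addN : left_inverse polyEnd_zero polyEnd_opp polyEnd_add.
Proof. by move=> f; apply: polyEndP => p /=; rewrite addNr. Qed.

HB.instance Definition _ := GRing.isZmodule.Build (polyEnd K)
  polyEnd_addA polyEnd_addC polyEnd_add0 polyEnd_addN.

Fact polyEnd_mulA : associative polyEnd_mul.
Proof. by move=> f g h; apply: polyEndP. Qed.
Fact polyEnd_mul1l : left_id polyEnd_one polyEnd_mul.
Proof. by move=> f; apply: polyEndP. Qed.
Fact polyEnd_mul1r : right_id polyEnd_one polyEnd_mul.
Proof. by move=> f; apply: polyEndP. Qed.
Fact polyEnd_mulDl : left_distributive polyEnd_mul +%R.
Proof. by move=> f g h; apply: polyEndP. Qed.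
Fact polyEnd_mulDr : right_distributive polyEnd_mul +%R.
Proof. by move=> f g h; apply: polyEndP => p; apply: linearD. Qed.
Fact polyEnd_1neq0 : polyEnd_one != 0.
Proof.
apply/eqP => /(congr1 (fun f : polyEnd K => f 1)) /= /eqP.
by apply/negP; apply: oner_neq0.
Qed.

HB.instance Definition _ := GRing.Zmodule_isNzRing.Build (polyEnd K)
  polyEnd_mulA polyEnd_mul1l polyEnd_mul1r polyEnd_mulDl polyEnd_mulDr
  polyEnd_1neq0.

Fact polyEnd_scaleA c d f :
  polyEnd_scale c (polyEnd_scale d f) = polyEnd_scale (c * d) f.
Proof. by apply: polyEndP => p /=; rewrite scalerA. Qed.
Fact polyEnd_scale1 : left_id 1 polyEnd_scale.
Proof. by move=> f; apply: polyEndP => p /=; rewrite scale1r. Qed.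
Fact polyEnd_scaleDr : right_distributive polyEnd_scale +%R.
Proof. by move=> c f g; apply: polyEndP => p /=; rewrite scalerDr. Qed.
Fact polyEnd_scaleDl f : {morph polyEnd_scale^~ f : c d / c + d}.
Proof. by move=> c d; apply: polyEndP => p /=; rewrite scalerDl. Qed.

HB.instance Definition _ := GRing.Zmodule_isLmodule.Build K (polyEnd K)
  polyEnd_scaleA polyEnd_scale1 polyEnd_scaleDr polyEnd_scaleDl.

Fact polyEnd_scaleAl (c : K) f g : c *: (f * g) = c *: f * g.
Proof. exact: polyEndP. Qed.

HB.instance Definition _ :=
  GRing.Lmodule_isLalgebra.Build K (polyEnd K) polyEnd_scaleAl.

Fact polyEnd_scaleAr (c : K) f g : c *: (f * g) = f * (c *: g).
Proof. by apply: polyEndP => p; apply/esym; apply: linearZ. Qed.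

HB.instance Definition _ :=
  GRing.Lalgebra_isAlgebra.Build K (polyEnd K) polyEnd_scaleAr.

End PolyEndAlgebra.

Section Subalgebras.
Variables (K : fieldType) (A : algType K).
Implicit Types (B I G : set A) (a : A).

Definition subalg_gen G : set A :=
  smallest (fun S : set A => GRing.subalg_closed (mem S)) G.

Definition lin_span G : set A :=
  smallest (fun S : set A => GRing.submod_closed (mem S)) G.

Definition fin_gen_alg B : Prop := exists s : seq A, B = subalg_gen [set` s].

Definition Cen B a : set A := [set b | B b /\ GRing.comm b a].

(* Below, B is meant to be a subalgebra of A: these are the one-sided ideals
   of the ring B, not of A. *)
Definition left_ideal B I : Prop :=
  [/\ I `<=` B, GRing.zmod_closed (mem I) &
      forall b x, B b -> I x -> I (b * x)].

Definition right_ideal B I : Prop :=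
  [/\ I `<=` B, GRing.zmod_closed (mem I) &
      forall b x, B b -> I x -> I (x * b)].

Definition left_noetherian B : Prop :=
  forall I, left_ideal B I ->
    exists s : seq A, I = smallest (left_ideal B) [set` s].

Definition right_noetherian B : Prop :=
  forall I, right_ideal B I ->
    exists s : seq A, I = smallest (right_ideal B) [set` s].

Definition noetherian B : Prop := left_noetherian B /\ right_noetherian B.

Definition set_add (S T : set A) : set A := [set s + t | s in S & t in T].

End Subalgebras.

Section IntegroDifferential.
Variable K : fieldType.

Definition opX : polyEnd K :=
  'X \*o idfun : {linear {poly K} -> {poly K}}.

Definition opD : polyEnd K := @deriv K : {linear {poly K} -> {poly K}}.

Definition poly_int (p : {poly K}) : {poly K} :=
  'X * \poly_(i < size p) (p`_i / i.+1%:R).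

Fact coef_poly_int p i :
  (poly_int p)`_i = if i == 0 then 0 else p`_i.-1 / i%:R.
Proof.
rewrite coefXM; case: i => //= i; rewrite coef_poly.
by case: ltnP => // le_p_i; rewrite nth_default ?mul0r.
Qed.

Fact poly_int_is_linear : linear poly_int.
Proof.
move=> c p q; apply/polyP => i.
rewrite coefD coefZ !coef_poly_int coefD coefZ.
by case: eqP => _; rewrite ?mulr0 ?addr0 // mulrDl mulrA.
Qed.

HB.instance Definition _ := GRing.isLinear.Build K {poly K} {poly K} _
  poly_int poly_int_is_linear.

Fact poly_intXn n : poly_int 'X^n = n.+1%:R^-1 *: 'X^(n.+1).
Proof.
apply/polyP => i; rewrite coef_poly_int coefZ !coefXn.
case: i => [|i] /=; first by rewrite mulr0.
by rewrite eqSS; case: eqP => [->|_]; rewrite ?mul1r ?mulr1 ?mul0r ?mulr0.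
Qed.

Definition opInt : polyEnd K := poly_int : {linear {poly K} -> {poly K}}.

Definition scalars : set (polyEnd K) := range (fun c : K => c%:A).

Definition I1 : set (polyEnd K) := subalg_gen [set` [:: opX; opD; opInt]].

Definition opH : polyEnd K := opD * opX.

Definition e_ (i j : nat) : polyEnd K :=
  opInt ^+ i * opD ^+ j - opInt ^+ i.+1 * opD ^+ j.+1.

Definition F : set (polyEnd K) :=
  lin_span (range (fun ij : nat * nat => e_ ij.1 ij.2)).

Definition polyH : set (polyEnd K) := range (horner_alg opH).

End IntegroDifferential.

Arguments scalars K : clear implicits.
Arguments I1 K : clear implicits.
Arguments F K : clear implicits.
Arguments polyH K : clear implicits.

(* Main.v *)
Require Import Defs.
From mathcomp Require Import all_boot all_order all_algebra.
From mathcomp Require Import boolp classical_sets.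
From mathcomp Require Import zify ring.
Set Implicit Arguments.
Unset Strict Implicit.
Unset Printing Implicit Defensive.
Import GRing.Theory.
Local Open Scope classical_set_scope.
Local Open Scope ring_scope.

(** In the basis of divided powers x^j / j! the operators d/dx and the
    integral are the two shifts, H is diagonal with entries 1, 2, 3, ..., and
    e_ij is the matrix unit.  Hence the elements of I_1 are band matrices, each
    diagonal of which is given by a polynomial from some column on
    ([I1_poly_diagonals]), and F consists of the matrices with finitely many
    nonzero entries ([F_supported]).  A nonzero polynomial over a field of
    characteristic zero has no root among the large integers.  So an element
    of I_1 not in K[H] + F has, below or above the main diagonal, an outermost
    diagonal that is not eventually zero, and that diagonal has no zeros far
    out ([I1_trichotomy]).  Let C be the centralizer of a.

    If a is not in K[H] + F, suppose that this diagonal lies below the main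
    one, at distance m.  Then a raises large degrees by exactly m, so that
    K[x] is a finitely generated K[a]-module.  An element of C is K[a]-linear,
    hence determined by finitely many of its columns, and C embeds into a
    finite power of K[x] as a K[a]-module.  Finite generation of C and of its
    one-sided ideals as K[a]-modules then comes from division by leading terms
    ([lead_fin_gen], [rising_fin_gen]).  If the diagonal lies above, exchange
    rows and columns.

    If a = p(H) + f with f in F, then C contains e_jj for all large j.  The
    elements of C with finitely many nonzero columns form a left ideal; given
    finitely many of them, all columns from some common place on vanish, the
    same holds in the left ideal that they generate, and some e_jj is missing
    from it.  Exchanging rows and columns, C is neither left nor right
    Noetherian ([Cen_polyH_plus_F_not_noetherian]).

    If moreover p is not constant, comparing entries far out shows that C is
    contained in K[H] + F.  Any finitely many elements of K[H] + F have their
    finite parts in one square, hence so has the algebra that they generate,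
    and again some e_jj is missing ([Cen_nonconst_polyH_not_fin_gen]).

    If p is constant, C is the centralizer of a matrix f with support in the
    n x n corner.  It contains the copy Int^n I_1 D^n of I_1 acting on the
    remaining basis vectors, and the part of C lying in the corner of size
    n + 1 is finite-dimensional.  Together these generate C: the off-diagonal
    blocks are sums of products of corner elements with matrix units of the
    copy ([Cen_scalar_plus_F_fin_gen]). *)

(** * Subspaces, subalgebras and one-sided ideals *)

Section Closure.
Variables (K : fieldType) (A : algType K).
Implicit Types (S G B I : set A) (a : A).

Definition subspace S :=
  S 0 /\ forall (c : K) u v, S u -> S v -> S (c *: u + v).
Definition subalgebra S :=
  [/\ S 1, forall (c : K) u v, S u -> S v -> S (c *: u + v)
         & forall u v, S u -> S v -> S (u * v)].

Lemma submod_closedP S : GRing.submod_closed (mem S) <-> subspace S.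
Proof.
split=> -[S0 SL]; split=> [|c u v]; rewrite ?in_setE //.
- by move: S0; rewrite in_setE.
- by have := SL c u v; rewrite !in_setE.
- exact: SL.
Qed.

Lemma zmod_closedP S :
  GRing.zmod_closed (mem S) <-> S 0 /\ forall u v, S u -> S v -> S (u - v).
Proof.
split=> -[S0 SB]; split=> [|u v]; rewrite ?in_setE //.
- by move: S0; rewrite in_setE.
- by have := SB u v; rewrite !in_setE.
- exact: SB.
Qed.

Lemma subalg_closedP S : GRing.subalg_closed (mem S) <-> subalgebra S.
Proof.
split=> -[S1 SL SM]; split=> [|c u v|u v]; rewrite ?in_setE //.
- by move: S1; rewrite in_setE.
- by have := SL c u v; rewrite !in_setE.
- by have := SM u v; rewrite !in_setE.
- exact: SL.
- exact: SM.
Qed.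

Lemma subalgebra_subspace S : subalgebra S -> subspace S.
Proof.
case=> S1 SL _; split=> //.
by have := SL (-1) _ _ S1 S1; rewrite scaleN1r addNr.
Qed.

Section SubspaceTheory.
Variables (S : set A) (S_sub : subspace S).
Lemma subspace0 : S 0. Proof. by case: S_sub. Qed.
Lemma subspaceZ (c : K) u : S u -> S (c *: u).
Proof.
by case: S_sub => S0 SL Su; rewrite -[_ *: _]addr0; apply: SL.
Qed.
Lemma subspaceD u v : S u -> S v -> S (u + v).
Proof. by case: S_sub => _ SL Su Sv; rewrite -[u]scale1r; apply: SL. Qed.
Lemma subspaceB u v : S u -> S v -> S (u - v).
Proof.
by case: S_sub => _ SL Su Sv; rewrite addrC -scaleN1r; apply: SL.
Qed.
Lemma subspace_sum (T : Type) (r : seq T) (P : pred T) (f : T -> A) :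
  (forall i, P i -> S (f i)) -> S (\sum_(i <- r | P i) f i).
Proof.
by move=> Sf; elim/big_ind: _ => //; [exact: subspace0|exact: subspaceD].
Qed.
End SubspaceTheory.

Lemma subalg_genP G : subalgebra (subalg_gen G).
Proof.
split=> [|c u v Su Sv|u v Su Sv] S [Salg GS];
  move/subalg_closedP: (Salg) => [S1 SL SM] //.
  by apply: SL; [exact: Su|exact: Sv].
by apply: SM; [exact: Su|exact: Sv].
Qed.

Lemma subalg_gen_incl G : G `<=` subalg_gen G.
Proof. exact: sub_gen_smallest. Qed.

Lemma subalg_gen_sub G S : subalgebra S -> G `<=` S -> subalg_gen G `<=` S.
Proof. by move=> /subalg_closedP Salg; apply: smallest_sub. Qed.

Lemma lin_spanP G : subspace (lin_span G).
Proof.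
split=> [|c u v Su Sv] S [Salg GS]; move/submod_closedP: (Salg) => [S1 SL] //.
by apply: SL; [exact: Su|exact: Sv].
Qed.

Lemma lin_span_incl G : G `<=` lin_span G.
Proof. exact: sub_gen_smallest. Qed.

Lemma lin_span_sub G S : subspace S -> G `<=` S -> lin_span G `<=` S.
Proof. by move=> /submod_closedP; apply: smallest_sub. Qed.

Lemma Cen_subalgebra B a : subalgebra B -> subalgebra (Cen B a).
Proof.
case=> B1 BL BM; split.
- by split=> //; apply/commr_sym/commr1.
- move=> c u v [Bu ua] [Bv va]; split; first exact: BL.
  by rewrite /GRing.comm mulrDl mulrDr -scalerAl -scalerAr ua va.
- move=> u v [Bu ua] [Bv va]; split; first exact: BM.
  by rewrite /GRing.comm -mulrA va mulrA ua mulrA.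
Qed.

Lemma left_ideal_subspace B I : subalgebra B -> left_ideal B I -> subspace I.
Proof.
move=> Balg [_ /zmod_closedP[I0 IB] IM]; have [B1 _ _] := Balg.
have IZ (c : K) u : I u -> I (c *: u).
  move=> Iu; rewrite -[u]mul1r scalerAl; apply: IM => //.
  exact: (subspaceZ (subalgebra_subspace Balg)).
split=> // c u v Iu Iv; rewrite -[v]opprK.
by apply: (IB (c *: u)); [exact: IZ|rewrite -scaleN1r; exact: IZ].
Qed.

Lemma right_ideal_subspace B I : subalgebra B -> right_ideal B I -> subspace I.
Proof.
move=> Balg [_ /zmod_closedP[I0 IB] IM]; have [B1 _ _] := Balg.
have IZ (c : K) u : I u -> I (c *: u).
  move=> Iu; rewrite -[u]mulr1 scalerAr; apply: IM => //.
  exact: (subspaceZ (subalgebra_subspace Balg)).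
split=> // c u v Iu Iv; rewrite -[v]opprK.
by apply: (IB (c *: u)); [exact: IZ|rewrite -scaleN1r; exact: IZ].
Qed.

Lemma Cen_scalar_add B (c : K) a : Cen B (c%:A + a) = Cen B a.
Proof.
have cb (b : A) : GRing.comm b c%:A by exact/commr_sym/comm_alg.
apply/seteqP; split=> b [Bb ba]; split=> //; last exact: commrD.
by move: ba; rewrite /GRing.comm mulrDl mulrDr cb => /addrI.
Qed.

End Closure.

(** * Matrices of operators in the basis of divided powers *)

Section Matrices.
Variables (K : fieldType) (charK0 : [pchar K] =i pred0).
Implicit Types (a b c : polyEnd K) (i j k n : nat).

Lemma natf_neq0_char0 n : ((n%:R : K) == 0) = (n == 0).
Proof. by move/pcharf0P: charK0 => ->. Qed.

Lemma fact_neq0 n : (n`!%:R : K) != 0.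
Proof. by rewrite natf_neq0_char0 -lt0n fact_gt0. Qed.

(** In this basis differentiation and integration lower and raise the index by
    one, without coefficients. *)
Definition dpow j : {poly K} := (j`!%:R)^-1 *: 'X^j.

Definition entry b i j : K := i`!%:R * (b (dpow j))`_i.

Lemma coef_entry b i j : (b (dpow j))`_i = entry b i j / i`!%:R.
Proof. by rewrite /entry mulrC mulKf ?fact_neq0. Qed.

Lemma polyE_dpow (p : {poly K}) M : (size p <= M)%N ->
  p = \sum_(i < M) (i`!%:R * p`_i) *: dpow i.
Proof.
move=> pM; rewrite -{1}[p]coefK poly_def.
rewrite (big_ord_widen M (fun i => p`_i *: 'X^i)) // big_mkcond /=.
apply: eq_bigr => i _; rewrite /dpow scalerA mulrC mulKf ?fact_neq0 //.
by case: ltnP => // ?; rewrite nth_default ?scale0r.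
Qed.

Lemma polyEnd_sum b n (x : 'I_n -> K) (p : 'I_n -> {poly K}) :
  b (\sum_(i < n) x i *: p i) = \sum_(i < n) x i *: b (p i).
Proof. by rewrite linear_sum; apply: eq_bigr => i _; exact: linearZ. Qed.

Lemma entryP b c : (forall i j, entry b i j = entry c i j) -> b = c.
Proof.
move=> bc; apply: polyEndP => p.
rewrite (polyE_dpow (leqnn (size p))) !polyEnd_sum; apply: eq_bigr => j _.
by congr (_ *: _); apply/polyP => i; rewrite (coef_entry b) (coef_entry c) bc.
Qed.

Lemma entryL (x : K) b c i j :
  entry (x *: b + c) i j = x * entry b i j + entry c i j.
Proof. by rewrite /entry coefD coefZ mulrDr mulrCA. Qed.
Lemma entryZ (x : K) b i j : entry (x *: b) i j = x * entry b i j.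
Proof. by rewrite /entry coefZ mulrCA. Qed.
Lemma entryD b c i j : entry (b + c) i j = entry b i j + entry c i j.
Proof. by rewrite /entry coefD mulrDr. Qed.
Lemma entryB b c i j : entry (b - c) i j = entry b i j - entry c i j.
Proof. by rewrite /entry coefD coefN mulrDr mulrN. Qed.
Lemma entry0 i j : entry 0 i j = 0.
Proof. by rewrite /entry coef0 mulr0. Qed.
Lemma entry1 i j : entry 1 i j = (i == j)%:R.
Proof.
rewrite /entry /= coefZ coefXn; case: eqP => [->|_]; last by rewrite !mulr0.
by rewrite mulr1 mulfV // fact_neq0.
Qed.
Lemma entry_sum (T : Type) (r : seq T) (P : pred T) (f : T -> polyEnd K) i j :
  entry (\sum_(t <- r | P t) f t) i j = \sum_(t <- r | P t) entry (f t) i j.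
Proof.
by elim/big_rec2: _ => [|t x y _ <-]; rewrite ?entry0 ?entryD.
Qed.

Lemma entry_eventually0 b j : exists M, forall i, (M <= i)%N -> entry b i j = 0.
Proof.
by exists (size (b (dpow j))) => i ?; rewrite /entry nth_default ?mulr0.
Qed.

(** The product is a finite sum because a column has finitely many nonzero
    entries; the cut-off M may be any bound for the column of [c]. *)
Lemma entryM b c i k M : (forall j, (M <= j)%N -> entry c j k = 0) ->
  entry (b * c) i k = \sum_(j < M) entry b i j * entry c j k.
Proof.
move=> cM; rewrite {1}/entry /=.
have sM : (size (c (dpow k)) <= M)%N.
  by apply/leq_sizeP => j /cM; rewrite coef_entry => ->; rewrite mul0r.
rewrite (polyE_dpow sM) polyEnd_sum coef_sum mulr_sumr; apply: eq_bigr => j _.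
by rewrite coefZ /entry; ring.
Qed.

Lemma entryM_D b i j : entry (opD K * b) i j = entry b i.+1 j.
Proof.
by rewrite /entry /= coef_deriv -[_ *+ i.+1]mulr_natl mulrA -natrM mulnC -factS.
Qed.

Lemma entryM_Int b i j :
  entry (opInt K * b) i j = if i == 0 then 0 else entry b i.-1 j.
Proof.
rewrite /entry /= coef_poly_int; case: i => [|i] /=; first by rewrite mulr0.
rewrite factS natrM; field; by rewrite nat1r natf_neq0_char0.
Qed.

Lemma entryM_X b i j : entry (opX K * b) i j = i%:R * entry b i.-1 j.
Proof.
rewrite /entry /= coefXM; case: i => [|i] /=; first by rewrite mulr0 mul0r.
by rewrite factS natrM mulrA.
Qed.

Lemma entryM_H b i j : entry (opH K * b) i j = i.+1%:R * entry b i j.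
Proof. by rewrite /opH -mulrA entryM_D entryM_X. Qed.

Lemma entryM_Dn n b i j : entry (opD K ^+ n * b) i j = entry b (i + n) j.
Proof.
elim: n b i => [|n IH] b i; first by rewrite mul1r addn0.
by rewrite exprS -mulrA entryM_D IH addSnnS.
Qed.

Lemma entryM_Intn n b i j :
  entry (opInt K ^+ n * b) i j = if (i < n)%N then 0 else entry b (i - n) j.
Proof.
elim: n b i => [|n IH] b i; first by rewrite mul1r subn0.
rewrite exprS -mulrA entryM_Int IH; case: i => //= i.
Qed.

Lemma entry_Dn n i j : entry (opD K ^+ n) i j = (i + n == j)%N%:R.
Proof. by rewrite -[_ ^+ n]mulr1 entryM_Dn entry1. Qed.

Lemma entry_Intn n i j : entry (opInt K ^+ n) i j = (i == j + n)%N%:R.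
Proof.
rewrite -[_ ^+ n]mulr1 entryM_Intn entry1.
case: ltnP => h; first by case: eqP => // hh; lia.
by congr (_ %:R); congr nat_of_bool; lia.
Qed.

Lemma entry_mulIntn n b i j : entry (b * opInt K ^+ n) i j = entry b i (j + n).
Proof.
rewrite (@entryM _ _ _ _ (j + n).+1); last first.
  by move=> k hk; rewrite entry_Intn; case: eqP => // ?; lia.
rewrite (bigD1 (inord (j + n))) //= entry_Intn inordK // eqxx mulr1.
rewrite big1 ?addr0 // => k /eqP hk; rewrite entry_Intn.
case: eqP => [e|]; last by rewrite mulr0.
by case: hk; apply: val_inj; rewrite /= inordK // -e.
Qed.

Lemma entry_mulDn n b i j :
  entry (b * opD K ^+ n) i j = if (j < n)%N then 0 else entry b i (j - n).
Proof.
rewrite (@entryM _ _ _ _ j.+1); last first.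
  by move=> k hk; rewrite entry_Dn; case: eqP => // ?; lia.
case: ltnP => hn.
  rewrite big1 // => k _; rewrite entry_Dn.
  by case: eqP => [?|]; [lia|rewrite mulr0].
rewrite (bigD1 (inord (j - n))) //= entry_Dn inordK ?ltnS ?leq_subr //.
rewrite subnK // eqxx mulr1 big1 ?addr0 // => k /eqP hk; rewrite entry_Dn.
case: eqP => [e|]; last by rewrite mulr0.
by case: hk; apply: val_inj; rewrite /= inordK; lia.
Qed.

Lemma mulDInt n : opD K ^+ n * opInt K ^+ n = 1.
Proof.
by apply: entryP => i j; rewrite entryM_Dn entry_Intn entry1 eqn_add2r.
Qed.

(** The operators e_ij are matrix units: the two shifts by j - i agree
    except at the basis vector of index j, which only the first one keeps. *)
Lemma entry_e i j r k : entry (e_ K i j) r k = ((r == i) && (k == j))%:R.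
Proof.
rewrite /e_ entryB !entryM_Intn !entry_Dn.
case: (ltnP r i) => h1; case: (ltnP r i.+1) => h2; try lia;
  rewrite ?subr0 ?sub0r.
- by case: eqP => // ?; lia.
- by congr (_ %:R); congr nat_of_bool; lia.
- rewrite (_ : (r == i) && (k == j) = false); last lia.
  by rewrite (_ : (r - i + j = r - i.+1 + j.+1)%N) ?subrr //; lia.
Qed.

Lemma entryM_e i j b r k : entry (e_ K i j * b) r k = (r == i)%:R * entry b j k.
Proof.
have [M0 M0P] := entry_eventually0 b k.
rewrite (@entryM _ _ _ _ (maxn M0 j).+1); last by move=> l hl; apply: M0P; lia.
have jM : (j < (maxn M0 j).+1)%N by lia.
rewrite (bigD1 (inord j)) //= entry_e inordK // eqxx andbT big1 ?addr0 //.
move=> l /eqP hl; rewrite entry_e.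
case: (nat_of_ord l =P j) => [e|]; last by rewrite andbF mul0r.
by case: hl; apply: val_inj; rewrite /= inordK // e.
Qed.

Lemma entry_mule i j b r k :
  entry (b * e_ K i j) r k = entry b r i * (k == j)%:R.
Proof.
rewrite (@entryM _ _ _ _ i.+1); last first.
  by move=> l hl; rewrite entry_e; case: eqP => // ?; lia.
rewrite (bigD1 ord_max) //= entry_e eqxx /= big1 ?addr0 // => l /eqP hl.
rewrite entry_e; case: (nat_of_ord l =P i) => [e|]; last by rewrite mulr0.
by case: hl; apply: val_inj.
Qed.

(** The entries of H are i + 1 rather than i because H = (d/dx) x. *)
Lemma entry_horner (p : {poly K}) i j :
  entry (horner_alg (opH K) p) i j = p.[i.+1%:R] * (i == j)%:R.
Proof.
elim/poly_ind: p i j => [|p c IH] i j.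
  by rewrite raddf0 entry0 horner0 mul0r.
rewrite raddfD /= [p * 'X](mulrC p 'X) rmorphM /= horner_algX horner_algC.
rewrite entryD entryM_H IH entryZ entry1.
by rewrite !hornerE /=; ring.
Qed.

Definition supported n b :=
  forall i j, (n <= i)%N || (n <= j)%N -> entry b i j = 0.

Lemma supported_subspace n : subspace (supported n).
Proof.
split=> [i j _|x u v su sv i j h]; first exact: entry0.
by rewrite entryL su // sv // mulr0 addr0.
Qed.

Lemma supportedW n m b : (n <= m)%N -> supported n b -> supported m b.
Proof. by move=> nm sb i j h; apply: sb; lia. Qed.

Lemma supported_e n i j : (i < n)%N -> (j < n)%N -> supported n (e_ K i j).
Proof.
move=> hi hj r k h; rewrite entry_e.
by rewrite (_ : (r == i) && (k == j) = false) //; lia.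
Qed.

Lemma supportedM n b c : supported n b -> supported n c -> supported n (b * c).
Proof.
move=> sb sc i k h; rewrite (@entryM _ _ _ _ n); last first.
  by move=> j ?; apply: sc; lia.
rewrite big1 // => j _; case/orP: h => h; first by rewrite sb ?h ?mul0r.
by rewrite sc ?h ?orbT ?mulr0.
Qed.

(** A finitely supported matrix is the sum of its entries times matrix units,
    and boundedness of the support is stable under linear combinations. *)
Lemma F_supported b : F K b <-> exists n, supported n b.
Proof.
split=> [Fb|[n sb]].
  move: b Fb; apply: lin_span_sub => [|_ [[i j] _ <-]]; last first.
    by exists (maxn i j).+1; apply: supported_e => /=; lia.
  split=> [|x u v [n su] [m sv]]; first by exists 0 => i j _; apply: entry0.
  exists (maxn n m); have [_ L] := supported_subspace (maxn n m).
  by apply: L; [apply: supportedW su|apply: supportedW sv]; lia.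
have -> : b = \sum_(i < n) \sum_(j < n) entry b i j *: e_ K i j.
  apply: entryP => r k; rewrite entry_sum.
  under eq_bigr => i _ do rewrite entry_sum.
  case: (boolP ((n <= r)%N || (n <= k)%N)) => [h|].
    rewrite sb // big1 // => i _; rewrite big1 // => j _.
    by rewrite entryZ (@supported_e n) // mulr0.
  rewrite negb_or -!ltnNge => /andP[hr hk].
  rewrite (bigD1 (Ordinal hr)) //= (bigD1 (Ordinal hk)) //=.
  rewrite entryZ entry_e !eqxx mulr1 !big1 ?addr0 // => [i hi|j hj].
    rewrite big1 // => j _; rewrite entryZ entry_e [r == i]eq_sym.
    by rewrite -val_eqE /= in hi; rewrite (negbTE hi) mulr0.
  rewrite entryZ entry_e [k == j]eq_sym.
  by rewrite -val_eqE /= in hj; rewrite (negbTE hj) andbF mulr0.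
have S := lin_spanP (range (fun ij : nat * nat => e_ K ij.1 ij.2)).
apply: (subspace_sum S) => i _; apply: (subspace_sum S) => j _.
by apply: (subspaceZ S); apply: lin_span_incl; exists (i : nat, j : nat).
Qed.

End Matrices.

(** * Leading positions and finite generation *)

(** This is the division argument behind the Noetherian property of modules
    over K[t], for a space S whose elements have finitely supported coordinate
    families h v, and where an operator T, playing the role of t, moves every
    sufficiently far leading position by exactly m. Neither a multiplicative
    structure nor linearity of T enters, so that it applies both to T = id on
    a finite-dimensional space and to modules of operators. *)

Section LeadingPosition.
Variables (K : fieldType) (A : algType K).
Variables (h : A -> nat -> K) (T : A -> A) (S : set A) (m L : nat).
Hypothesis hL : forall (x : K) u v k, h (x *: u + v) k = x * h u k + h v k.

Definition lead v n := h v n != 0 /\ forall k, (n < k)%N -> h v k = 0.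

Hypothesis S_sub : subspace S.
Hypothesis h_fin : forall v, S v -> exists M, forall k, (M <= k)%N -> h v k = 0.
Hypothesis h_inj : forall v, S v -> (forall k, h v k = 0) -> v = 0.
Hypothesis S_stable : forall v, S v -> S (T v).
Hypothesis m_gt0 : (0 < m)%N.
Hypothesis T_lead :
  forall v n, S v -> (L <= n)%N -> lead v n -> lead (T v) (n + m).

Let D n := exists2 v, S v & lead v n.

(** The set of leading positions is stable under adding m far out, so each
    residue class modulo m either contains no leading position beyond L or
    contains all positions from some point on. *)
Lemma lead_descent :
  exists B, forall n, (B <= n)%N -> D n ->
    [/\ (m <= n)%N, (L <= n - m)%N & D (n - m)].
Proof.
have /choice[g gP] : forall r, exists n0, forall n, (L <= n)%N -> D n ->
    (n %% m)%N = r -> [/\ (L <= n0)%N, D n0 & (n0 %% m)%N = r].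
  move=> r; have [[n0 H]|H] :=
    pselect (exists n0, [/\ (L <= n0)%N, D n0 & (n0 %% m)%N = r]).
    by exists n0.
  by exists 0%N => n Ln Dn nr; case: H; exists n.
exists (\sum_(r < m) g r + m + L)%N => n nB Dn.
have r_lt : (n %% m < m)%N by rewrite ltn_mod.
have gn : (g (n %% m)%N <= \sum_(r < m) g r)%N.
  by rewrite (bigD1 (Ordinal r_lt)) //= leq_addr.
have Ln : (L <= n)%N by lia.
have [Lg Dg gr] := gP _ _ Ln Dn erefl.
have Dk k : D (g (n %% m) + k * m)%N.
  elim: k => [|k [v Sv vl]]; first by rewrite addn0.
  exists (T v); first exact: S_stable.
  by rewrite mulSn addnCA addnC; apply: T_lead => //; lia.
have -> : (n - m = g (n %% m) + (n %/ m - 1 - g (n %% m) %/ m) * m)%N.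
  move: gr (divn_eq (g (n %% m)%N) m) (divn_eq n m) gn nB => -> /=.
  move: (\sum_(r < m) g r)%N (g (n %% m)%N) => s x.
  by move: (n %/ m)%N (n %% m)%N (x %/ m)%N => y z t; nia.
split; [lia|lia|exact: Dk].
Qed.

(** Generators: one element for each leading position below the bound of
    [lead_descent]. Beyond it every leading term is that of T u for some u
    with a smaller leading position, so subtraction terminates. *)
Lemma lead_fin_gen : exists s : seq A, [set` s] `<=` S /\
  forall S', subspace S' -> (forall v, S' v -> S' (T v)) -> [set` s] `<=` S' ->
    S `<=` S'.
Proof.
have [B BP] := lead_descent.
have /choice[f fP] : forall n, exists v, S v /\ (D n -> lead v n).
  move=> n; have [[v Sv vn]|nD] := pselect (D n); first by exists v.
  by exists 0; split=> //; exact: subspace0.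
exists [seq f n | n <- iota 0 B]; split=> [_ /mapP[n _ ->]|S' S'sub S'T sS'].
  by have [] := fP n.
suff H n : forall v, S v -> (forall k, (n <= k)%N -> h v k = 0) -> S' v.
  by move=> v Sv; have [M MP] := h_fin Sv; exact: H MP.
elim: n => [|n IH] v Sv v0.
  by rewrite (h_inj Sv) => [|k]; [exact: subspace0|exact: v0].
have [vn0|vn0] := eqVneq (h v n) 0.
  apply: IH => // k; rewrite leq_eqVlt => /orP[/eqP <- //|]; exact: v0.
have Dn : D n by exists v.
suff [u [Su S'u [un0 uk]]] : exists u, [/\ S u, S' u & lead u n].
  rewrite -[v](subrK ((h v n / h u n) *: u)).
  apply: (subspaceD S'sub); last exact: (subspaceZ S'sub).
  apply: IH; first by apply: (subspaceB S_sub) => //; exact: (subspaceZ S_sub).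
  move=> k; rewrite addrC -scaleNr hL leq_eqVlt => /orP[/eqP <-|nk].
    by rewrite mulNr divfK // addNr.
  by rewrite (uk k nk) (v0 k nk) mulr0 addr0.
have [Sf fl] := fP n; case: (ltnP n B) => nB.
  exists (f n); split=> //; last exact: fl.
  by apply: sS'; apply/mapP; exists n; rewrite // mem_iota.
have [mn Lnm [u Su ul]] := BP n nB Dn.
exists (T u); split; first exact: S_stable.
  apply/S'T/IH => // k nk; case: ul => _; apply; lia.
by rewrite -(subnK mn); apply: T_lead.
Qed.

End LeadingPosition.

(** * Rising matrices *)

(** For each v the function g v i is the i-th vector of a family in the space
    of finitely supported sequences, on which al acts as a matrix. The
    hypotheses gT1 and gT2 say that v intertwines: T v is obtained both by
    applying al to every vector and by recombining the vectors according to
    al. With g v i the i-th column of v and al = a, or g v i the i-th row of v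
    and al the transpose of a, this expresses that v commutes with a. *)

Section Rising.
Variable K : fieldType.

(** From column N on, the lowest nonzero entry of column j is in row j + m,
    and earlier columns end above row j + m. As a map, [al] then raises every
    degree from N on by exactly m. *)
Definition rising (al : nat -> nat -> K) m N := (0 < m)%N /\
  forall j, (N <= j)%N -> al (j + m)%N j != 0 /\
    forall r i, (r < j)%N -> (j + m <= i)%N -> al i r = 0.

Variables (A : algType K) (g : A -> nat -> nat -> K) (T : A -> A) (S : set A).
Variables (al : nat -> nat -> K) (m N : nat).
Hypothesis al_rising : rising al m N.
Hypothesis gL :
  forall (x : K) u v i j, g (x *: u + v) i j = x * g u i j + g v i j.
Hypothesis S_sub : subspace S.
Hypothesis S_stable : forall v, S v -> S (T v).
Hypothesis g_fin :
  forall v i, S v -> exists M, forall j, (M <= j)%N -> g v i j = 0.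
Hypothesis g_inj : forall v, S v -> (forall i j, g v i j = 0) -> v = 0.
Hypothesis gT1 : forall v i j, S v -> exists M0, forall M, (M0 <= M)%N ->
  g (T v) i j = \sum_(r < M) al j r * g v i r.
Hypothesis gT2 : forall v i j, S v -> exists M0, forall M, (M0 <= M)%N ->
  g (T v) i j = \sum_(r < M) al r i * g v r j.

Let m_gt0 : (0 < m)%N. Proof. by case: al_rising. Qed.

(** The first N + m vectors of the basis generate the whole space under [al],
    so an intertwining family is determined by its first N + m members. *)
Lemma rising_determined v : S v ->
  (forall i j, (i < N + m)%N -> g v i j = 0) -> v = 0.
Proof.
move=> Sv v0; apply: g_inj => // i; have [k] := ubnP i.
elim: k i => // k IH i; rewrite ltnS => ik j.
case: (ltnP i (N + m)) => [|Ni]; first exact: v0.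
have [al_top _] := (al_rising.2 (i - m)%N ltac:(lia)).
have [_ al_above] := (al_rising.2 (i - m).+1%N ltac:(lia)).
rewrite subnK in al_top; last by lia.
have [M1 /(_ _ (leqnn _)) E1] := gT1 (i - m)%N j Sv.
rewrite big1 in E1; last by move=> r _; rewrite IH ?mulr0; [|lia].
have [M2 M2P] := gT2 (i - m)%N j Sv.
have iM : (i < (maxn M2 i).+1)%N by lia.
(* In the recombination of the family at i - m the last term is member i,
   with a nonzero coefficient. *)
have := M2P (maxn M2 i).+1 ltac:(lia).
rewrite E1 (bigD1 (Ordinal iM)) //= big1 ?addr0 => [/eqP|r].
  by rewrite eq_sym mulf_eq0 (negbTE al_top) => /eqP.
rewrite -val_eqE /= => ri; case: (ltnP r i) => ri'.
  by rewrite IH ?mulr0 //; lia.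
by rewrite al_above ?mul0r //; lia.
Qed.

(** The finitely many sequences g v 0, ..., g v (q - 1) are interleaved into
    one, in which [al] moves leading positions by m * q. *)
Lemma rising_fin_gen : exists s : seq A, [set` s] `<=` S /\
  forall S', subspace S' -> (forall v, S' v -> S' (T v)) -> [set` s] `<=` S' ->
    S `<=` S'.
Proof.
pose q := (N + m)%N; have q_gt0 : (0 < q)%N by rewrite /q; lia.
pose h v k := g v (k %% q)%N (k %/ q)%N.
have hE v i j : (i < q)%N -> h v (j * q + i)%N = g v i j.
  move=> iq; by rewrite /h modnMDl modn_small // divnMDl // divn_small // addn0.
apply: (@lead_fin_gen _ _ h T S (m * q) (N * q)) => //.
- by move=> x u v k; rewrite /h gL.
- move=> v Sv; have /choice[M MP] := fun i => g_fin i Sv.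
  exists ((\sum_(i < q) M i) * q)%N => k kM; apply: MP.
  have kq : (k %% q < q)%N by rewrite ltn_mod.
  apply: (@leq_trans (\sum_(i < q) M i)%N); last by rewrite leq_divRL.
  by rewrite (bigD1 (Ordinal kq)) //= leq_addr.
- move=> v Sv v0; apply: rising_determined => // i j iq.
  by rewrite -hE.
- by rewrite muln_gt0 m_gt0.
move=> v n Sv; rewrite (divn_eq n q).
have : (n %% q < q)%N by rewrite ltn_mod.
move: (n %% q)%N (n %/ q)%N => i j {n} iq Nj [vn vk].
have {}Nj : (N <= j)%N.
  have : (N * q < j.+1 * q)%N by lia.
  by rewrite ltn_pmul2r.
(* Positions are ordered lexicographically, first by row, then by member of
   the family. *)
have above i' r : (i' < q)%N -> (j < r)%N || (j == r) && (i < i')%N ->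
    g v i' r = 0.
  move=> iq' jr; rewrite -hE // vk //.
  case/orP: jr => [jr|/andP[/eqP <-]]; last by rewrite ltn_add2l.
  have : (j.+1 * q <= r * q)%N by rewrite leq_pmul2r.
  lia.
have [al_top al0] := al_rising.2 _ Nj.
have [_ al1] := al_rising.2 j.+1 ltac:(lia).
have -> : (j * q + i + m * q = (j + m) * q + i)%N by lia.
split.
  rewrite hE //; have [M0 M0P] := gT1 i (j + m)%N Sv.
  have jM : (j < (maxn M0 j).+1)%N by lia.
  rewrite (M0P (maxn M0 j).+1); last by lia.
  rewrite (bigD1 (Ordinal jM)) //= big1 ?addr0 => [|r].
    by rewrite mulf_neq0 // -hE.
  rewrite -val_eqE /= => rj; case: (ltnP r j) => rj'.
    by rewrite al0 ?mul0r.
  by rewrite above ?mulr0 //; lia.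
move=> k; rewrite (divn_eq k q).
have : (k %% q < q)%N by rewrite ltn_mod.
move: (k %% q)%N (k %/ q)%N => i' j' {k} iq' lt.
have jj : (j + m <= j')%N.
  have : ((j + m) * q < j'.+1 * q)%N by lia.
  by rewrite ltn_pmul2r.
rewrite hE //; have [M0 /(_ _ (leqnn _)) ->] := gT1 i' j' Sv.
rewrite big1 // => r _; case: (ltngtP r j) => rj.
- by rewrite al0 ?mul0r.
- by rewrite above ?mulr0 // rj.
- case: (ltngtP (j + m) j') => jj'.
  + by rewrite al1 ?mul0r // rj.
  + by lia.
  + by rewrite rj above ?mulr0 // eqxx orbC /=; nia.
Qed.

End Rising.

(** * Diagonals are eventually polynomial *)

Section PolynomialDiagonals.
Variables (K : fieldType) (charK0 : [pchar K] =i pred0).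
Implicit Types (p : {poly K}) (a b c f : polyEnd K).

Lemma natr_inj_char0 i j : (i%:R == j%:R :> K) = (i == j).
Proof.
wlog ij : i j / (i <= j)%N => [H|].
  by case/orP: (leq_total i j) => /H //; rewrite eq_sym => ->; rewrite eq_sym.
rewrite eq_sym -subr_eq0 -natrB // (natf_neq0_char0 charK0).
by rewrite subn_eq0 eqn_leq ij.
Qed.

(** Induction on the degree, splitting off an integer root if there is one: in
    characteristic zero it can be equal to only one integer. *)
Lemma poly_eventually_neq0 p : p != 0 ->
  exists N, forall j, (N <= j)%N -> p.[j%:R] != 0.
Proof.
have [n] := ubnP (size p); elim: n p => // n IH p pn p0.
have [[i /eqP pi]|no_root] := pselect (exists i : nat, p.[i%:R] == 0);
  last first.
  by exists 0%N => j _; apply/negP => pj; apply: no_root; exists j.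
have /factor_theorem[r pE] : root p i%:R by apply/rootP.
have r0 : r != 0 by apply: contraNneq p0 => r0; rewrite pE r0 mul0r.
have [|N NP] := IH r _ r0.
  by move: pn; rewrite pE size_Mmonic ?monicXsubC // size_XsubC addn2.
exists (maxn N i.+1) => j ij; rewrite pE !hornerE mulf_neq0 ?NP //; first lia.
by rewrite subr_eq0 natr_inj_char0; lia.
Qed.

(** Such a polynomial takes its value at N infinitely often. *)
Lemma poly_periodic_const p m N : (0 < m)%N ->
  (forall j, (N <= j)%N -> p.[(j + m)%:R] = p.[j%:R]) -> (size p <= 1)%N.
Proof.
move=> m0 pm; have per k : p.[(N + k * m)%:R] = p.[N%:R].
  by elim: k => [|k IH]; rewrite ?addn0 // mulSnr addnA pm ?leq_addr.
have [/eqP|/poly_eventually_neq0[M MP]] := eqVneq (p - p.[N%:R]%:P) 0.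
  by rewrite subr_eq0 => /eqP ->; exact: size_polyC_leq1.
have := MP (N + M * m)%N ltac:(nia).
by rewrite !hornerE per subrr eqxx.
Qed.

(** The diagonals are indexed by the offset row minus column, and w is the
    band width; only |k| <= w matters in P k. *)
Definition poly_diagonals b := exists w N (P : int -> {poly K}),
  (forall i j, (j + w < i)%N || (i + w < j)%N -> entry b i j = 0) /\
  (forall i j, (N <= j)%N -> (i <= j + w)%N -> (j <= i + w)%N ->
     entry b i j = (P (i%:Z - j%:Z)).[j%:R]).

(** Making the polynomials zero outside the band frees the second clause of
    [poly_diagonals] from its band conditions. *)
Lemma poly_diagonals_diag b w N (P : int -> {poly K}) :
  (forall i j, (j + w < i)%N || (i + w < j)%N -> entry b i j = 0) ->
  (forall i j, (N <= j)%N -> (i <= j + w)%N -> (j <= i + w)%N ->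
     entry b i j = (P (i%:Z - j%:Z)).[j%:R]) ->
  forall i j, (N <= j)%N -> entry b i j =
    (if (`|i%:Z - j%:Z| <= w)%N then P (i%:Z - j%:Z) else 0).[j%:R].
Proof.
move=> bw bP i j Nj; case: ifP => h; first by apply: bP => //; lia.
by rewrite horner0 bw //; lia.
Qed.

Lemma poly_diagonals_subspace : subspace poly_diagonals.
Proof.
split.
  exists 0%N, 0%N, (fun=> 0); split=> [i j _|i j _ _ _]; first exact: entry0.
  by rewrite entry0 horner0.
move=> x u v [w [N [P [bw bP]]]] [w' [N' [P' [bw' bP']]]].
exists (maxn w w'), (maxn N N'), (fun k : int =>
  x *: (if (`|k| <= w)%N then P k else 0) +
  (if (`|k| <= w')%N then P' k else 0)).
split=> [i j h|i j h _ _].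
  by rewrite entryL bw ?bw' ?mulr0 ?addr0 //; lia.
rewrite entryL (poly_diagonals_diag bw bP); last lia.
by rewrite (poly_diagonals_diag bw' bP') ?hornerE //; lia.
Qed.

Lemma poly_diagonals1 : poly_diagonals 1.
Proof.
exists 0%N, 0%N, (fun=> 1); split=> i j; rewrite (entry1 charK0).
  by case: eqP => // ->; lia.
by move=> _ h h'; rewrite hornerC (_ : i == j) //; lia.
Qed.

Lemma poly_diagonalsM_D b : poly_diagonals b -> poly_diagonals (opD K * b).
Proof.
move=> [w [N [P [bw bP]]]]; exists w.+1, N, (fun k : int =>
  if (`|(k + 1)%R| <= w)%N then P (k + 1) else 0).
split=> i j; rewrite entryM_D => h; first by rewrite bw //; lia.
move=> _ _; rewrite (poly_diagonals_diag bw bP) //.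
by rewrite (_ : i.+1%:Z - j%:Z = i%:Z - j%:Z + 1) //; lia.
Qed.

Lemma poly_diagonalsM_X b : poly_diagonals b -> poly_diagonals (opX K * b).
Proof.
move=> [w [N [P [bw bP]]]]; exists w.+1, (maxn N w.+2), (fun k : int =>
  ('X + k%:~R%:P) * (if (`|(k - 1)%R| <= w)%N then P (k - 1) else 0)).
split=> i j; rewrite entryM_X => h.
  by case: i h => [|i] h; rewrite ?mul0r // bw ?mulr0 //=; lia.
move=> _ hi; case: i hi => [|i] hi /=; first lia.
rewrite (poly_diagonals_diag bw bP) //; last lia.
rewrite (_ : i%:Z - j%:Z = i.+1%:Z - j%:Z - 1); last lia.
rewrite !hornerE; congr (_ * _).
by rewrite rmorphB /= addrC subrK.
Qed.

Lemma poly_diagonalsM_Int b : poly_diagonals b -> poly_diagonals (opInt K * b).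
Proof.
move=> [w [N [P [bw bP]]]]; exists w.+1, (maxn N w.+2), (fun k : int =>
  (if (`|(k - 1)%R| <= w)%N then P (k - 1) else 0)).
split=> i j; rewrite (entryM_Int charK0) => h.
  by case: i h => [|i] h //=; rewrite bw //; lia.
move=> _ hi; case: i hi => [|i] hi /=; first lia.
rewrite (poly_diagonals_diag bw bP) //; last lia.
by rewrite (_ : i%:Z - j%:Z = i.+1%:Z - j%:Z - 1) //; lia.
Qed.

(** Operators whose left multiplication preserves the property form a
    subalgebra, so only left multiplication by the three generators has to be
    examined; each is a shift of rows, up to a factor linear in the row
    number. *)
Lemma I1_poly_diagonals b : I1 K b -> poly_diagonals b.
Proof.
move=> Ib; suff H c : poly_diagonals c -> poly_diagonals (b * c).
  by rewrite -[b]mulr1; exact/H/poly_diagonals1.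
have evS := poly_diagonals_subspace; move: b Ib c.
apply: (@subalg_gen_sub _ _ _
  [set b | forall c, poly_diagonals c -> poly_diagonals (b * c)]).
  split=> [c|x u v Hu Hv c /[dup] /Hu ? /Hv ?|u v Hu Hv c /Hv /Hu] /=.
  - by rewrite mul1r.
  - by rewrite mulrDl -scalerAl; apply: evS.2.
  - by rewrite mulrA.
move=> u /=; rewrite !inE => /or3P[] /eqP -> c.
- exact: poly_diagonalsM_X.
- exact: poly_diagonalsM_D.
- exact: poly_diagonalsM_Int.
Qed.

Lemma I1_row_finite b i : I1 K b ->
  exists M, forall j, (M <= j)%N -> entry b i j = 0.
Proof.
move=> /I1_poly_diagonals[w [N [P [bw _]]]]; exists (i + w).+1 => j h.
by rewrite bw //; lia.
Qed.

Definition polyH_plus_F := set_add (polyH K) (F K).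

Lemma max_witness (Q : nat -> Prop) w n : Q n -> (n <= w)%N ->
  exists m, [/\ Q m, (m <= w)%N & forall k, (m < k <= w)%N -> ~ Q k].
Proof.
move=> Qn nw; have [d] := ubnP (w - n).
elim: d n Qn nw => // d IH n Qn nw nd.
have [[k [Qk nk kw]]|H] := pselect (exists k, [/\ Q k, (n < k)%N & (k <= w)%N]).
  by apply: (IH k) => //; lia.
by exists n; split=> // k /andP[nk kw] Qk; apply: H; exists k.
Qed.

(** Take the outermost offset m whose polynomial is nonzero, below and then
    above the main diagonal; if there is none on either side, the matrix
    agrees far out with a polynomial in H. *)
Lemma I1_trichotomy b : I1 K b ->
  [\/ exists m N, rising (entry b) m N,
      exists m N, rising (fun i j => entry b j i) m N | polyH_plus_F b].
Proof.
move=> /I1_poly_diagonals[w [N [P [bw bP]]]].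
have [[m0 [[m00 Pm0] m0w]]|noup] := pselect (exists m : nat,
    ((0 < m)%N /\ P m%:Z != 0) /\ (m <= w)%N).
  have [m [[m_gt0 Pm] mw mmax]] := max_witness
    (Q := fun m : nat => (0 < m)%N /\ P m%:Z != 0) (conj m00 Pm0) m0w.
  have [N1 N1P] := poly_eventually_neq0 Pm.
  apply: Or31; exists m, (N + N1 + w).+1; split=> // j hj; split.
    rewrite bP; [|lia|lia|lia].
    by rewrite (_ : (j + m)%:Z - j%:Z = m%:Z) ?N1P //; lia.
  move=> r i rj ji; case: (ltnP (r + w) i) => h; first by rewrite bw ?h.
  rewrite bP; [|lia|lia|lia].
  have -> : i%:Z - r%:Z = (i - r)%N%:Z by lia.
  have /asboolPn := mmax (i - r)%N ltac:(lia).
  rewrite asbool_and /= negb_and => /orP[/asboolP|/asboolP]; first lia.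
  by move=> /negP; rewrite negbK => /eqP ->; rewrite horner0.
have [[m0 [[m00 Pm0] m0w]]|nodown] := pselect (exists m : nat,
    ((0 < m)%N /\ P (- m%:Z) != 0) /\ (m <= w)%N).
  have [m [[m_gt0 Pm] mw mmax]] := max_witness
    (Q := fun m : nat => (0 < m)%N /\ P (- m%:Z) != 0) (conj m00 Pm0) m0w.
  have [N1 N1P] := poly_eventually_neq0 Pm.
  apply: Or32; exists m, (N + N1 + w).+1; split=> // j hj; split.
    rewrite bP; [|lia|lia|lia].
    by rewrite (_ : j%:Z - (j + m)%:Z = - m%:Z) ?N1P //; lia.
  move=> r i rj ji; case: (ltnP (r + w) i) => h; first by rewrite bw ?h ?orbT.
  rewrite bP; [|lia|lia|lia].
  have -> : r%:Z - i%:Z = - (i - r)%N%:Z by lia.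
  have /asboolPn := mmax (i - r)%N ltac:(lia).
  rewrite asbool_and /= negb_and => /orP[/asboolP|/asboolP]; first lia.
  by move=> /negP; rewrite negbK => /eqP ->; rewrite horner0.
(* The shift of the variable compensates for the entries i + 1 of H. *)
apply: Or33; pose p := P 0 \Po ('X - 1).
exists (horner_alg (opH K) p); first by exists p.
exists (b - horner_alg (opH K) p); last by rewrite addrC subrK.
apply/(F_supported charK0); exists (N + w).+1 => i j h.
rewrite entryB (entry_horner charK0) /p horner_comp !hornerE.
have [e|ij] := eqVneq i j.
  rewrite mulr1 e bP; [|lia|lia|lia].
  by rewrite subrr -natr1 addrK subrr.
rewrite mulr0 subr0.
case: (boolP ((j + w < i)%N || (i + w < j)%N)) => [|h']; first exact: bw.
rewrite bP; [|lia|lia|lia].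
case: (ltnP j i) => ji.
  have -> : i%:Z - j%:Z = (i - j)%N%:Z by lia.
  have [->|Pij] := eqVneq (P (i - j)%N%:Z) 0; first by rewrite horner0.
  by case: noup; exists (i - j)%N; split; [split=> //|]; lia.
have -> : i%:Z - j%:Z = - (j - i)%N%:Z by lia.
have [->|Pij] := eqVneq (P (- (j - i)%N%:Z)) 0; first by rewrite horner0.
by case: nodown; exists (j - i)%N; split; [split=> //|]; lia.
Qed.

Lemma entryM_horner p b i j :
  entry (horner_alg (opH K) p * b) i j = p.[i.+1%:R] * entry b i j.
Proof.
have [M MP] := entry_eventually0 b j.
rewrite (@entryM _ charK0 _ _ _ _ (maxn M i).+1); last first.
  by move=> k hk; apply: MP; lia.
have iM : (i < (maxn M i).+1)%N by lia.
rewrite (bigD1 (Ordinal iM)) //= (entry_horner charK0) eqxx mulr1.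
rewrite big1 ?addr0 // => k; rewrite -val_eqE /= => ki.
by rewrite (entry_horner charK0) eq_sym (negbTE ki) mulr0 mul0r.
Qed.

Lemma entry_mul_horner p b i j :
  entry (b * horner_alg (opH K) p) i j = entry b i j * p.[j.+1%:R].
Proof.
rewrite (@entryM _ charK0 _ _ _ _ j.+1); last first.
  move=> k hk; rewrite (entry_horner charK0).
  by case: eqP => [?|]; [lia|rewrite mulr0].
rewrite (bigD1 ord_max) //= (entry_horner charK0) eqxx mulr1.
rewrite big1 ?addr0 // => k; rewrite -val_eqE /= => ki.
by rewrite (entry_horner charK0) (negbTE ki) !mulr0.
Qed.

Lemma entryM_supported n f b i j :
  supported n f -> (n <= i)%N -> entry (f * b) i j = 0.
Proof.
move=> sf ni; have [M MP] := entry_eventually0 b j.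
by rewrite (entryM charK0 _ _ MP) big1 // => k _; rewrite sf ?ni ?mul0r.
Qed.

Lemma entry_mul_supported n f b i j :
  supported n f -> (n <= j)%N -> entry (b * f) i j = 0.
Proof.
move=> sf nj; rewrite (@entryM _ charK0 _ _ _ _ n); last first.
  by move=> k h; rewrite sf ?h.
by rewrite big1 // => k _; rewrite sf ?nj ?orbT ?mulr0.
Qed.

(** Far out, an entry of b in position (i, j) is multiplied by p(i + 1) on one
    side and by p(j + 1) on the other.  An off-diagonal without zeros would
    therefore force p to be periodic. *)
Lemma comm_nonconst_polyH p f b : (1 < size p)%N -> F K f -> I1 K b ->
  GRing.comm b (horner_alg (opH K) p + f) -> polyH_plus_F b.
Proof.
move=> p1 /(F_supported charK0)[n sf] Ib.
rewrite /GRing.comm mulrDl mulrDr => ba.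
have E i j : (n <= i)%N -> (n <= j)%N ->
    entry b i j * p.[j.+1%:R] = p.[i.+1%:R] * entry b i j.
  move=> ni nj; move/(congr1 (fun c => entry c i j)): ba.
  rewrite !entryD entryM_horner entry_mul_horner (entryM_supported _ _ sf) //.
  by rewrite (entry_mul_supported _ _ sf) // !addr0.
have no_period m N : (0 < m)%N ->
    ~ forall j, (N <= j)%N -> p.[(j + m).+1%:R] = p.[j.+1%:R].
  move=> m0 per; move: p1; rewrite ltnNge => /negP; apply.
  apply: (@poly_periodic_const _ m N.+1 m0) => -[//|j] h.
  by rewrite addSn per.
case: (I1_trichotomy Ib) => // -[m [N [m0 R]]];
  case: (no_period m (n + N)%N m0) => j hj.
  have [nz _] := R j ltac:(lia); apply: (mulfI nz).
  by rewrite (E (j + m)%N j) 1?mulrC //; lia.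
have [nz _] := R j ltac:(lia); apply: (mulfI nz).
by rewrite /= (E j (j + m)%N) 1?mulrC //; lia.
Qed.

End PolynomialDiagonals.

(** * Matrix units in I_1 *)

Section Centralizers.
Variables (K : fieldType) (charK0 : [pchar K] =i pred0).
Implicit Types (p : {poly K}) (a b c f u v : polyEnd K).

Lemma I1_subalgebra : subalgebra (I1 K).
Proof. exact: subalg_genP. Qed.

Lemma Cen_I1_subalgebra a : subalgebra (Cen (I1 K) a).
Proof. exact: (Cen_subalgebra _ I1_subalgebra). Qed.

Lemma I1X : I1 K (opX K).
Proof. by apply: subalg_gen_incl; rewrite /= !inE eqxx. Qed.
Lemma I1D : I1 K (opD K).
Proof. by apply: subalg_gen_incl; rewrite /= !inE eqxx orbT. Qed.
Lemma I1Int : I1 K (opInt K).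
Proof. by apply: subalg_gen_incl; rewrite /= !inE eqxx !orbT. Qed.

Lemma I1_exp b n : I1 K b -> I1 K (b ^+ n).
Proof.
have [I1_1 _ I1M] := I1_subalgebra.
by move=> Ib; elim: n => [|n IH]; rewrite ?expr0 // exprS; apply: I1M.
Qed.

Lemma I1_e i j : I1 K (e_ K i j).
Proof.
have [_ _ I1M] := I1_subalgebra.
apply: (subspaceB (subalgebra_subspace I1_subalgebra));
  apply: I1M; apply: I1_exp;
  [exact: I1Int|exact: I1D|exact: I1Int|exact: I1D].
Qed.

(** * Operators outside K[H] + F *)

(** A lowest diagonal below the main one is used through columns, an outermost
    one above it through rows, where the transpose of a is rising. *)
Lemma Cen_module_fin_gen a S :
  (exists m N, rising (entry a) m N) \/
  (exists m N, rising (fun i j => entry a j i) m N) ->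
  subspace S -> S `<=` Cen (I1 K) a -> (forall c, S c -> S (a * c)) ->
  exists s : seq (polyEnd K), [set` s] `<=` S /\
    forall S', subspace S' -> (forall c, S' c -> S' (a * c)) ->
      [set` s] `<=` S' -> S `<=` S'.
Proof.
move=> rise S_sub SC S_stable.
have comm c : S c -> a * c = c * a by move=> /SC[_ ->].
case: rise => -[m [N R]].
  apply: (@rising_fin_gen _ _ (fun c i j => entry c j i) _ _ _ m N R) => //.
  - by move=> *; rewrite entryL.
  - by move=> c i _; exact: entry_eventually0.
  - by move=> c _ c0; apply: (entryP charK0) => i j; rewrite c0 entry0.
  - move=> c i j _; have [M0 M0P] := entry_eventually0 c i.
    exists M0 => M hM; apply: (entryM charK0) => r hr; apply: M0P; lia.
  - move=> c i j Sc; have [M0 M0P] := entry_eventually0 a i.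
    exists M0 => M hM; rewrite comm // (@entryM _ charK0 _ _ _ _ M).
      by apply: eq_bigr => r _; rewrite mulrC.
    by move=> r hr; apply: M0P; lia.
apply: (@rising_fin_gen _ _ (@entry K) _ _ _ m N R) => //.
- by move=> *; rewrite entryL.
- by move=> c i /SC[Ic _]; exact: I1_row_finite.
- by move=> c _ c0; apply: (entryP charK0) => i j; rewrite c0 entry0.
- move=> c i j Sc; have [M0 M0P] := entry_eventually0 a j.
  exists M0 => M hM; rewrite comm // (@entryM _ charK0 _ _ _ _ M).
    by apply: eq_bigr => r _; rewrite mulrC.
  by move=> r hr; apply: M0P; lia.
- move=> c i j _; have [M0 M0P] := entry_eventually0 c j.
  exists M0 => M hM; apply: (entryM charK0) => r hr; apply: M0P; lia.
Qed.

(** Since a is central in C, left and right ideals of C are K[a]-modules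
    alike. *)
Lemma Cen_outside_polyH_plus_F a : I1 K a -> ~ polyH_plus_F a ->
  [/\ fin_gen_alg (Cen (I1 K) a), left_noetherian (Cen (I1 K) a) &
      right_noetherian (Cen (I1 K) a)].
Proof.
move=> Ia a_out; set C := Cen _ _.
have C_alg : subalgebra C by exact: Cen_I1_subalgebra.
have Ca : C a by [].
have fg S : subspace S -> S `<=` C -> (forall c, S c -> S (a * c)) -> _ :=
  @Cen_module_fin_gen a S (match I1_trichotomy charK0 Ia with
    | Or31 H => or_introl H | Or32 H => or_intror H
    | Or33 H => False_ind _ (a_out H) end).
have [_ _ CM] := C_alg.
split.
- have [//|c Cc|s [sC sgen]] := fg C (subalgebra_subspace C_alg).
    exact: CM.
  exists (a :: s); apply/seteqP; split.
    have G_alg := subalg_genP [set` (a :: s)]; have [_ _ GM] := G_alg.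
    apply: sgen; first exact: subalgebra_subspace.
      move=> c Gc; apply: GM => //; apply: subalg_gen_incl.
      by rewrite /= inE eqxx.
    by move=> c sc; apply: subalg_gen_incl; rewrite /= inE [_ \in _]sc orbT.
  apply: subalg_gen_sub => // c /=; rewrite inE => /orP[/eqP -> //|]; exact: sC.
- move=> I I_id; have [IC _ IM] := I_id.
  have [c Ic|s [sI sgen]] := fg I (left_ideal_subspace C_alg I_id) IC.
    exact: IM.
  exists s; apply/seteqP; split; last exact: smallest_sub.
  move=> c Ic X [X_id sX]; have [XC _ XM] := X_id.
  apply: sgen Ic => //; first exact: (left_ideal_subspace C_alg).
  by move=> x Xx; apply: XM.
- move=> I I_id; have [IC _ IM] := I_id.
  have swap X c : right_ideal C X -> X c -> X (a * c).
    move=> [XC _ XM] Xc; have [_ <-] := XC c Xc; exact: XM.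
  have [c Ic|s [sI sgen]] := fg I (right_ideal_subspace C_alg I_id) IC.
    exact: swap.
  exists s; apply/seteqP; split; last exact: smallest_sub.
  move=> c Ic X [X_id sX]; apply: sgen Ic => //.
    exact: (right_ideal_subspace C_alg).
  by move=> x Xx; apply: swap.
Qed.

(** * Failure of the Noetherian property inside K[H] + F *)

Lemma uniform_bound (Q : polyEnd K -> nat -> Prop) (s : seq (polyEnd K)) :
  (forall b n m, (n <= m)%N -> Q b n -> Q b m) ->
  (forall b, [set` s] b -> exists n, Q b n) ->
  exists n, forall b, [set` s] b -> Q b n.
Proof.
move=> Qmono; elim: s => [|x s IH] H; first by exists 0%N.
have [|n nP] := IH.
  by move=> b sb; apply: H; rewrite /= inE [_ \in s]sb orbT.
have [|m mP] := H x; first by rewrite /= inE eqxx.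
exists (maxn n m) => b /=; rewrite inE => /orP[/eqP -> |sb].
  by apply: Qmono mP; lia.
by apply: Qmono (nP b sb); lia.
Qed.

(** Meant for Z c j saying that column j, or row j, of c vanishes, and Id the
    left, or right, ideals of C. *)
Lemma ideals_not_fin_gen (C : set (polyEnd K)) (Id : set (polyEnd K) -> Prop)
    (Z : polyEnd K -> nat -> Prop) n0 :
  (forall j, (n0 <= j)%N -> C (e_ K j j)) ->
  (forall N, Id [set c | C c /\ forall j, (N <= j)%N -> Z c j]) ->
  Id [set c | C c /\ exists N, forall j, (N <= j)%N -> Z c j] ->
  (forall j k, (j < k)%N -> Z (e_ K j j) k) -> (forall j, ~ Z (e_ K j j) j) ->
  ~ forall I, Id I -> exists s : seq (polyEnd K), I = smallest Id [set` s].
Proof.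
move=> Ce IdN IdI Ze nZe /(_ _ IdI)[s sE].
have sI : [set` s] `<=`
    [set c | C c /\ exists N, forall j, (N <= j)%N -> Z c j].
  by rewrite sE; exact: sub_gen_smallest.
have [||N NP] := @uniform_bound (fun c N => forall j, (N <= j)%N -> Z c j) s.
- by move=> b n m nm H j mj; apply: H; lia.
- by move=> b /sI[].
have : smallest Id [set` s] (e_ K (maxn N n0) (maxn N n0)).
  rewrite -sE; split; first by apply: Ce; lia.
  by exists (maxn N n0).+1 => j hj; apply: Ze.
case/(_ _ (conj (IdN N) _)) => [c sc|_ /(_ (maxn N n0))].
  by split; [have [] := sI c sc|exact: NP].
by move/(_ ltac:(lia)); exact: nZe.
Qed.

Lemma not_noetherian_of_e a n0 :
  (forall j, (n0 <= j)%N -> Cen (I1 K) a (e_ K j j)) ->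
  ~ left_noetherian (Cen (I1 K) a) /\ ~ right_noetherian (Cen (I1 K) a).
Proof.
set C := Cen _ _ => Ce; have C_alg : subalgebra C by exact: Cen_I1_subalgebra.
have [C0 CL] := subalgebra_subspace C_alg; have [_ _ CM] := C_alg.
have CB u v : C u -> C v -> C (u - v).
  exact: (subspaceB (subalgebra_subspace C_alg)).
split.
- apply: (@ideals_not_fin_gen C _ (fun c j => forall i, entry c i j = 0)) => //.
  + exact: Ce.
  + move=> N; split; first by move=> c [].
      apply/zmod_closedP; split=> [|u v [Cu u0] [Cv v0]].
        by split=> // j _ i; rewrite entry0.
      by split=> [|j hj i]; [exact: CB|rewrite entryB u0 ?v0 ?subrr].
    move=> b x Cb [Cx x0]; split=> [|j hj i]; first exact: CM.
    by rewrite (@entryM _ charK0 _ _ _ _ 0) ?big_ord0 // => k _; rewrite x0.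
  + split; first by move=> c [].
      apply/zmod_closedP; split=> [|u v [Cu [N u0]] [Cv [M v0]]].
        by split=> //; exists 0%N => j _ i; rewrite entry0.
      split; first exact: CB.
      by exists (maxn N M) => j hj i; rewrite entryB u0 ?v0 ?subrr //; lia.
    move=> b x Cb [Cx [N x0]]; split; first exact: CM.
    exists N => j hj i.
    by rewrite (@entryM _ charK0 _ _ _ _ 0) ?big_ord0 // => k _; rewrite x0.
  + move=> j k jk i; rewrite (entry_e charK0).
    by rewrite (_ : k == j = false) ?andbF //; lia.
  + by move=> j /(_ j)/eqP; rewrite (entry_e charK0) !eqxx oner_eq0.
have rowM b c j : (forall i, entry b j i = 0) ->
    forall i, entry (b * c) j i = 0.
  move=> b0 i; have [M MP] := entry_eventually0 c i.
  by rewrite (entryM charK0 _ _ MP) big1 // => k _; rewrite b0 mul0r.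
apply: (@ideals_not_fin_gen C _ (fun c j => forall i, entry c j i = 0)) => //.
- exact: Ce.
- move=> N; split; first by move=> c [].
    apply/zmod_closedP; split=> [|u v [Cu u0] [Cv v0]].
      by split=> // j _ i; rewrite entry0.
    by split=> [|j hj i]; [exact: CB|rewrite entryB u0 ?v0 ?subrr].
  move=> b x Cb [Cx x0]; split=> [|j hj i]; first exact: CM.
  by apply: rowM; exact: x0.
- split; first by move=> c [].
    apply/zmod_closedP; split=> [|u v [Cu [N u0]] [Cv [M v0]]].
      by split=> //; exists 0%N => j _ i; rewrite entry0.
    split; first exact: CB.
    by exists (maxn N M) => j hj i; rewrite entryB u0 ?v0 ?subrr //; lia.
  move=> b x Cb [Cx [N x0]]; split; first exact: CM.
  by exists N => j hj; apply: rowM; exact: x0.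
- move=> j k jk i; rewrite (entry_e charK0).
  by rewrite (_ : k == j = false) ?andbF //; lia.
- by move=> j /(_ j)/eqP; rewrite (entry_e charK0) !eqxx oner_eq0.
Qed.

Lemma Cen_e p f n j : supported n f -> (n <= j)%N ->
  Cen (I1 K) (horner_alg (opH K) p + f) (e_ K j j).
Proof.
move=> sf nj; split; first exact: I1_e.
apply: (entryP charK0) => r k; rewrite (entryM_e charK0).
rewrite (entry_mule charK0) !entryD !(entry_horner charK0).
rewrite sf ?nj // [entry f r j]sf ?nj ?orbT // !addr0.
have [->|rj] := eqVneq r j; have [_|_] := eqVneq k j;
  by rewrite ?eqxx ?mulr1 ?mul1r ?mulr0 ?mul0r //.
Qed.

Lemma Cen_polyH_plus_F_not_noetherian a : polyH_plus_F a ->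
  ~ left_noetherian (Cen (I1 K) a) /\ ~ right_noetherian (Cen (I1 K) a).
Proof.
move=> [_ [p _ <-] [f /(F_supported charK0)[n sf] <-]].
by apply: (@not_noetherian_of_e _ n) => j nj; exact: Cen_e sf nj.
Qed.

(** * Nonconstant polynomials in H, up to F *)

(** The elements q(H) + g with g supported in a fixed square form a
    subalgebra, and e_jj is not among them for j outside the square: q would
    vanish at all large integers. *)
Lemma Cen_nonconst_polyH_not_fin_gen p f : (1 < size p)%N -> F K f ->
  ~ fin_gen_alg (Cen (I1 K) (horner_alg (opH K) p + f)).
Proof.
move=> p1 Ff [s sE]; have [n sf] := (F_supported charK0 f).1 Ff.
pose X N b := exists q, supported N (b - horner_alg (opH K) q).
have [||N NP] := @uniform_bound (fun b N => X N b) s.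
- by move=> b N M NM [q bq]; exists q; apply: supportedW bq.
- move=> b sb; have : Cen (I1 K) (horner_alg (opH K) p + f) b.
    by rewrite sE; exact: subalg_gen_incl.
  case=> Ib /(comm_nonconst_polyH charK0 p1 Ff Ib).
  case=> _ [q _ <-] [g /(F_supported charK0)[N sg] <-].
  by exists N, q; rewrite addrC addKr.
have X_alg : subalgebra (X N).
  have [_ sL] := @supported_subspace K N.
  split=> [|x u v [q uq] [r vr]|u v [q uq] [r vr]].
  - by exists 1; rewrite rmorph1 subrr => i j _; rewrite entry0.
  - exists (x *: q + r); rewrite linearD linearZ /= opprD.
    rewrite -scalerAl mul1r addrACA -scalerBr.
    exact: sL.
  - exists (q * r); rewrite rmorphM /=.
    move: (horner_alg _ q) (horner_alg _ r) uq vr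
      (entryM_horner charK0 q) (entry_mul_horner charK0 r) => Q R uQ vR QM MR.
    have -> : u * v - Q * R = (u - Q) * (v - R) + (u - Q) * R + Q * (v - R).
      by rewrite -mulrDr subrK mulrBl mulrBr addrA subrK.
    have D := subspaceD (@supported_subspace K N).
    apply: (D); first apply: (D); first exact: (supportedM charK0).
      by move=> i j h; rewrite MR uQ // mul0r.
    by move=> i j h; rewrite QM vR // mulr0.
have : subalg_gen [set` s] (e_ K (maxn n N) (maxn n N)).
  by rewrite -sE; apply: Cen_e sf _; lia.
move: (maxn n N) (leq_maxr n N) => j Nj /(subalg_gen_sub X_alg NP)[q eq].
have q0 : q = 0.
  apply/eqP/negPn/negP => /(poly_eventually_neq0 charK0)[M MP].
  have := eq (maxn j.+1 M) (maxn j.+1 M) ltac:(lia).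
  rewrite entryB (entry_e charK0) (entry_horner charK0) eqxx mulr1.
  rewrite (_ : maxn j.+1 M == j = false) /=; last lia.
  by move/eqP; rewrite sub0r oppr_eq0; apply/negP/MP; lia.
have := eq j j ltac:(lia); rewrite q0 raddf0 subr0 (entry_e charK0) eqxx /=.
by move/eqP; rewrite oner_eq0.
Qed.

(** * Scalars up to F *)

Section ScalarPlusFinite.
Variables (n : nat) (f : polyEnd K).
Hypothesis sf : supported n f.
Let C := Cen (I1 K) f.
Let C_alg : subalgebra C := Cen_I1_subalgebra f.

(** This space is finite-dimensional; [lead_fin_gen] applies with T = id
    because no leading position exceeds the bound. The size n + 1 leaves one
    basis vector outside the support of f, through which the off-diagonal
    blocks of the centralizer will be factored. *)
Lemma Cen_corner_fin_gen : exists s : seq (polyEnd K),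
  [set` s] `<=` [set c | C c /\ supported n.+1 c] /\
  forall S', subspace S' -> [set` s] `<=` S' ->
    [set c | C c /\ supported n.+1 c] `<=` S'.
Proof.
pose h (c : polyEnd K) k := entry c (k %% n.+1)%N (k %/ n.+1)%N.
have [|||||||s [sS sgen]] := @lead_fin_gen _ _ h id
   [set c | C c /\ supported n.+1 c] 1 (n.+1 * n.+1).
- by move=> x u v k; rewrite /h entryL.
- have [_ sL] := @supported_subspace K n.+1.
  have [C0 CL] := subalgebra_subspace C_alg.
  split=> [|x u v [Cu su] [Cv sv]]; first by split=> // i j _; rewrite entry0.
  by split; [exact: CL|exact: sL].
- move=> c [_ sc]; exists (n.+1 * n.+1)%N => k hk; apply: sc.
  by rewrite leq_divRL ?hk ?orbT.
- move=> c [_ sc] c0; apply: (entryP charK0) => i j; rewrite entry0.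
  have [hi|hi] := ltnP i n.+1; last by rewrite sc ?hi.
  have := c0 (j * n.+1 + i)%N.
  by rewrite /h modnMDl modn_small // divnMDl // divn_small // addn0.
- by [].
- by [].
- move=> c k [_ sc] hk [/eqP + _]; case; apply: sc.
  by rewrite leq_divRL ?hk ?orbT.
by exists s; split=> // S' S'_sub; apply: sgen.
Qed.

Lemma shift_e i j : opInt K ^+ n * e_ K i j * opD K ^+ n = e_ K (n + i) (j + n).
Proof.
have E k l : opInt K ^+ n * (opInt K ^+ k * opD K ^+ l) * opD K ^+ n =
    opInt K ^+ (n + k) * opD K ^+ (l + n) by rewrite !exprD !mulrA.
by rewrite /e_ mulrBr mulrBl !E addnS addSn.
Qed.

(** With p = Int^n D^n the projection away from the corner and q = 1 - p, the
    four blocks of c are treated separately. *)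
Lemma Cen_scalar_plus_F_fin_gen : fin_gen_alg C.
Proof.
have [s [sS sgen]] := Cen_corner_fin_gen.
pose sh b := opInt K ^+ n * b * opD K ^+ n.
pose G := s ++ [:: sh 1; sh (opX K); sh (opD K); sh (opInt K)].
have fInt : f * opInt K ^+ n = 0.
  apply: (entryP charK0) => i j; rewrite (entry_mulIntn charK0).
  by rewrite entry0 sf //; lia.
have Df : opD K ^+ n * f = 0.
  by apply: (entryP charK0) => i j; rewrite entryM_Dn entry0 sf //; lia.
have [I1_1 _ I1M] := I1_subalgebra.
have [C1 _ CM] := C_alg.
have shC b : I1 K b -> C (sh b).
  move=> Ib; split.
    apply: (I1M); last exact: (I1_exp _ I1D).
    by apply: (I1M) => //; exact: (I1_exp _ I1Int).
  by rewrite /GRing.comm /sh -[LHS]mulrA Df mulr0 !mulrA fInt !mul0r.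
have G_alg := subalg_genP [set` G]; have G_sub := subalgebra_subspace G_alg.
have [_ GL GM] := G_alg.
have G_sh b : I1 K b -> subalg_gen [set` G] (sh b).
  apply: (@subalg_gen_sub _ _ _ [set b | subalg_gen [set` G] (sh b)]).
    split=> [|x u v Gu Gv|u v Gu Gv] /=.
    - by apply: subalg_gen_incl; rewrite /= mem_cat !inE eqxx orbT.
    - have -> : sh (x *: u + v) = x *: sh u + sh v.
        by rewrite /sh mulrDr mulrDl -scalerAr -scalerAl.
      exact: GL.
    - have -> : sh (u * v) = sh u * sh v; last exact: GM.
      rewrite /sh !mulrA; congr (_ * _ * _).
      by rewrite -[in RHS]mulrA (mulDInt charK0) mulr1.
  move=> u /=; rewrite !inE => /or3P[] /eqP ->;
    by apply: subalg_gen_incl; rewrite /= mem_cat !inE eqxx ?orbT.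
have G_e i j : (n <= i)%N -> (n <= j)%N -> subalg_gen [set` G] (e_ K i j).
  move=> ni nj; rewrite -(subnKC ni) -(subnK nj) -shift_e.
  exact: (G_sh _ (I1_e _ _)).
have G_corner c : C c -> supported n.+1 c -> subalg_gen [set` G] c.
  move=> Cc sc; apply: (sgen _ G_sub) => // x sx.
  by apply: subalg_gen_incl; rewrite /= mem_cat [x \in s]sx.
have f_e i j : (n <= i)%N -> f * e_ K i j = 0.
  move=> ni; apply: (entryP charK0) => r k.
  by rewrite (entry_mule charK0) entry0 sf ?mul0r // ni orbT.
have e_f i j : (n <= j)%N -> e_ K i j * f = 0.
  move=> nj; apply: (entryP charK0) => r k.
  by rewrite (entryM_e charK0) entry0 sf ?mulr0 // nj.
exists G; apply/seteqP; split; last first.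
  apply: subalg_gen_sub => // u /=; rewrite mem_cat => /orP[/sS[]//|].
  by rewrite !inE => /or4P[] /eqP ->; apply: shC => //;
    [exact: I1X|exact: I1D|exact: I1Int].
move=> c Cc; have [Ic cf] := Cc.
pose p : polyEnd K := sh 1; pose q : polyEnd K := 1 - p.
have Cp : C p by exact: shC.
have Cq : C q by exact: (subspaceB (subalgebra_subspace C_alg)).
have pM b i j : entry (p * b) i j = (n <= i)%N%:R * entry b i j.
  rewrite /p /sh mulr1 -mulrA (entryM_Intn charK0) entryM_Dn.
  by case: ltnP => h; rewrite ?mul0r // subnK // mul1r.
have Mp b i j : entry (b * p) i j = entry b i j * (n <= j)%N%:R.
  rewrite /p /sh mulr1 mulrA (entry_mulDn charK0) (entry_mulIntn charK0).
  by case: ltnP => h; rewrite ?mulr0 // subnK // mulr1.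
have qM b i j : entry (q * b) i j = (i < n)%N%:R * entry b i j.
  rewrite /q mulrBl mul1r entryB pM ltnNge.
  by case: leqP => _ /=; rewrite ?mul1r ?mul0r ?subrr ?subr0.
have Mq b i j : entry (b * q) i j = entry b i j * (j < n)%N%:R.
  rewrite /q mulrBr mulr1 entryB Mp ltnNge.
  by case: leqP => _ /=; rewrite ?mulr1 ?mulr0 ?subrr ?subr0.
have [w [_ [_ [band _]]]] := I1_poly_diagonals charK0 Ic.
have -> : c = p * c * p + q * c * q + q * c * p + p * c * q.
  apply: (entryP charK0) => i j; rewrite !entryD !(Mp, Mq) !(pM, qM).
  by rewrite ltnNge (ltnNge j); do 2!case: leqP => _ /=; ring.
have GD := subspaceD G_sub.
apply: (GD); first apply: (GD); first apply: (GD).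
- have -> : p * c * p = sh (opD K ^+ n * c * opInt K ^+ n).
    by rewrite /p /sh !mulr1 !mulrA.
  by apply: G_sh; apply: (I1M); [apply: (I1M) => //|]; apply: I1_exp;
    [exact: I1D|exact: I1Int].
- apply: G_corner; first by apply: (CM) => //; apply: (CM).
  move=> i j h; rewrite Mq qM.
  case: (ltnP i n) => hi; last by rewrite !mul0r.
  by case: (ltnP j n) => hj; [lia|rewrite mulr0].
(* Column j of the block, moved to column n, lies in the enlarged corner; the
   matrix unit e_nj moves it back. The band width bounds the number of terms.
   *)
- have Cu : C (q * c * p) by apply: (CM) => //; apply: (CM).
  have -> : q * c * p =
      \sum_(j < w) (q * c * p * e_ K (n + j) n) * e_ K n (n + j).
    apply: (entryP charK0) => i k; rewrite entry_sum.
    under eq_bigr => j _ do rewrite !(entry_mule charK0) eqxx mulr1.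
    case: (boolP ((n <= k)%N && (k < n + w)%N)) => [/andP[nk kw]|h].
      have kn : (k - n < w)%N by lia.
      rewrite (bigD1 (Ordinal kn)) //= subnKC // eqxx mulr1.
      rewrite big1 ?addr0 // => j; rewrite -val_eqE /= => jk.
      by rewrite (_ : k == _ = false) ?mulr0 //; lia.
    rewrite big1 => [|j _].
      rewrite Mp qM; case: (ltnP i n) => hi; last by rewrite !mul0r.
      case: (leqP n k) => hk; last by rewrite mulr0.
      by rewrite band ?mulr0 ?mul0r //; lia.
    by rewrite (_ : k == _ = false) ?mulr0 //; have := ltn_ord j; lia.
  apply: (subspace_sum G_sub) => j _; apply: (GM); last by apply: G_e; lia.
  have [Iu uf] := Cu; apply: G_corner.
    split; first by apply: (I1M) => //; exact: I1_e.
    rewrite /GRing.comm -[LHS]mulrA e_f // mulr0.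
    by rewrite mulrA -uf -mulrA f_e ?mulr0 //; lia.
  move=> r k h; rewrite (entry_mule charK0) Mp qM.
  case: (ltnP r n) => hr; last by rewrite !mul0r.
  by rewrite (_ : k == n = false) ?mulr0 //; lia.
(* The same with rows in place of columns. *)
have Cu : C (p * c * q) by apply: (CM) => //; apply: (CM).
have -> : p * c * q =
    \sum_(i < w) e_ K (n + i) n * (e_ K n (n + i) * (p * c * q)).
  apply: (entryP charK0) => r k; rewrite entry_sum.
  under eq_bigr => i _ do rewrite !(entryM_e charK0) eqxx mul1r.
  case: (boolP ((n <= r)%N && (r < n + w)%N)) => [/andP[nr rw]|h].
    have rn : (r - n < w)%N by lia.
    rewrite (bigD1 (Ordinal rn)) //= subnKC // eqxx mul1r.
    rewrite big1 ?addr0 // => i; rewrite -val_eqE /= => ir.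
    by rewrite (_ : r == _ = false) ?mul0r //; lia.
  rewrite big1 => [|i _].
    rewrite Mq pM; case: (ltnP k n) => hk; last by rewrite !mulr0.
    case: (leqP n r) => hr; last by rewrite !mul0r.
    by rewrite band ?mulr0 ?mul0r //; lia.
  by rewrite (_ : r == _ = false) ?mul0r //; have := ltn_ord i; lia.
apply: (subspace_sum G_sub) => i _; apply: (GM); first by apply: G_e; lia.
have [Iu uf] := Cu; apply: G_corner.
  split; first by apply: (I1M) => //; exact: I1_e.
  rewrite /GRing.comm -[LHS]mulrA uf mulrA e_f ?mul0r; last by lia.
  by rewrite [RHS]mulrA f_e ?mul0r.
move=> r k h; rewrite (entryM_e charK0) Mq pM.
case: (ltnP k n) => hk; last by rewrite !mulr0.
by rewrite (_ : r == n = false) ?mul0r //; lia.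
Qed.

End ScalarPlusFinite.

End Centralizers.

Theorem corollary5p9 (K : fieldType) (charK0 : [pchar K] =i pred0)
    (a : polyEnd K) (aI1 : a \in I1 K `\` scalars K) :
  let C := Cen (I1 K) a in
  let KF := set_add (scalars K) (F K) in
  let KHF := set_add (polyH K) (F K) in
  [/\ (* (1) *)
      fin_gen_alg C <-> a \notin KHF `\` KF,
      (* (2) *)
      [/\ (fin_gen_alg C /\ ~ noetherian C)
            <-> a \in KF `\` scalars K,
          (fin_gen_alg C /\ ~ left_noetherian C)
            <-> a \in KF `\` scalars K &
          (fin_gen_alg C /\ ~ right_noetherian C)
            <-> a \in KF `\` scalars K] &
      (* (3) *)
      [/\ (~ fin_gen_alg C /\ ~ noetherian C) <-> a \in KHF `\` KF,
          (~ fin_gen_alg C /\ ~ left_noetherian C) <-> a \in KHF `\` KF &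
          (~ fin_gen_alg C /\ ~ right_noetherian C) <-> a \in KHF `\` KF]].
Proof.
move: aI1; rewrite in_setE => -[Ia a_nscalar] C KF KHF.
rewrite notin_setE !in_setE /setD /= /noetherian.
have KF_KHF : KF a -> KHF a.
  case=> _ [c _ <-] [f Ff <-]; exists c%:A; last by exists f.
  by exists c%:P => //; rewrite horner_algC.
have [aKHF|naKHF] := pselect (KHF a); last first.
  have [Cfg Cl Cr] := Cen_outside_polyH_plus_F charK0 Ia naKHF.
  have naKF : ~ KF a by move/KF_KHF.
  by split; [|split|split]; tauto.
have [nCl nCr] := Cen_polyH_plus_F_not_noetherian charK0 aKHF.
have [aKF|naKF] := pselect (KF a).
  have Cfg : fin_gen_alg C.
    case: aKF => _ [c _ <-] [f /(F_supported charK0)[n sf] fE].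
    rewrite /C -fE Cen_scalar_add.
    exact: (Cen_scalar_plus_F_fin_gen charK0 sf).
  by split; [|split|split]; tauto.
have nCfg : ~ fin_gen_alg C.
  case: aKHF naKF => _ [p _ <-] [f Ff fE] naKF; rewrite /C -fE.
  apply: Cen_nonconst_polyH_not_fin_gen => //; rewrite ltnNge.
  apply/negP => /size1_polyC pE.
  apply: naKF; exists (p`_0)%:A; first by exists p`_0.
  by exists f => //; rewrite -fE pE horner_algC coefC.
by split; [|split|split]; tauto.
Qed.
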